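(* In order that $(D;G)\underline{\int}_E g(I)$ and $(D;G)\overline{\int}_E g(I)$ should be finite for every Lebesgue measurable set $E$ in $W$ it is necessary and sufficient that $g(I)$ should be of bounded variation in $W$ with respect to $G$, i.e. that $\mathrm{Var}(g;W;G)<\infty$.
   Context: $W=[A,B]$ with $A<B$ is a fixed closed interval. An interval is any of $(a,b),[a,b),(a,b],[a,b]$ with $A\le a<b\le B$; $mI=b-a$, and $m$ also denotes Lebesgue measure. Two intervals (or sets) overlap if they have a non-degenerate interval in common. An $I^\sigma$ is a finite union of intervals; $+$ between sets denotes union. $E'$ is the derived set of $E$. $S$ is a fixed set of intervals and $g:S\to\mathbb R$. $\bar S$ is the collection of all $I^\sigma$ which are finite unions of points of $W$ and interiors of intervals of $S$; it is assumed that $W\in\bar S$. A division $D$ of an $I^\sigma$ $R$ is a finite set of pairwise non-overlapping intervals of $S$ (each with its own end-point brackets), the union of whose closures is $R'$; norm$(D)$ is the greatest length of its intervals; the end-points of its intervals are its division-points. A Riemann succession of divisions of $R$ is a sequence $\{D_n\}$ of divisions of $R$ with norm$(D_n)\to0$. $D^{(1)}+D^{(2)}$ is the division formed by all the intervals of divisions $D^{(1)},D^{(2)}$ of two non-overlapping sets. $F$ is a family of Riemann successions of divisions of sets $R\in\bar S$, and $G$ is the set of all divisions occurring in them, such that: (i) for every $R\in\bar S$ there is at least one Riemann succession of divisions of $R$ in $F$; (ii) if $\{D_n\}\in F$ and $n_i\to\infty$ are integers, then $\{D_{n_i}\}\in F$; (iii) if $R_1,R_2\in\bar S$ are non-overlapping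 and $\{D_{1,n}\},\{D_{2,n}\}\in F$ are over $R_1,R_2$, then $\{D_{1,n}+D_{2,n}\}\in F$; (vi) whenever $I\in\bar S$ is an interval with $I=I_1+I_2+\{x\}$, $x$ being the common end-point of intervals $I_1,I_2\in\bar S$, and $\{D_n\}\in F$ is over $I$, there are $\{D_{1,n}\},\{D_{2,n}\}\in F$ over $I_1,I_2$ such that $D_{1,n}+D_{2,n}=D_n$ if $x$ is a division-point of $D_n$, while if $x$ is inside an interval $J_n$ of $D_n$ then $D_{1,n}+D_{2,n}$ consists of the intervals of $D_n$ other than $J_n$ (same brackets) together with one interval $J_{1,n}$ of $D_{1,n}$ and one interval $J_{2,n}$ of $D_{2,n}$ with $J_{1,n}'+J_{2,n}'=J_n'$; (vii) if $R_1,R_2\in\bar S$ and $R_1\subset R_2$ then $R_2-R_1'$ (if non-empty) is in $\bar S$; (viii) if $I\in S$, the division of $I$ consisting of $I$ alone is in $G$. For measurable $E\subset W$ put $K(I)=\dfrac{g(I)\,m(E\cap I)}{mI}$ for $I\in S$. The upper density integral is $(D;G)\overline{\int}_E g(I)=\lim_{e\to0}\sup\{\sum_{I\in D}K(I):D\in G\text{ a division of }W,\ \mathrm{norm}(D)<e\}$; the lower density integral $(D;G)\underline{\int}_E g(I)$ is the same with $\inf$. $\mathrm{Var}(g;W;G)=\lim_{e\to0}\sup\{\sum_{I\in D}|g(I)|:D\in G\text{ a division of }W,\ \mathrm{norm}(D)<e\}$. *)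

(* Defs.v *)
From mathcomp Require Import all_boot all_order all_algebra finmap.
From mathcomp Require Import all_classical all_reals all_analysis.

Set Implicit Arguments.
Unset Strict Implicit.
Unset Printing Implicit Defensive.

Import Order.TTheory GRing.Theory Num.Theory.
Import numFieldNormedType.Exports.

Local Open Scope classical_set_scope.
Local Open Scope ring_scope.

(* An interval, together with its brackets, is a term [I : interval R] of
   the library, and [[set` I]] is its set of points. *)

Definition itv_lo {R : realType} (I : interval R) : R :=
  if I is Interval (BSide _ a) _ then a else 0.

Definition itv_hi {R : realType} (I : interval R) : R :=
  if I is Interval _ (BSide _ b) then b else 0.

Definition itv_len {R : realType} (I : interval R) : R := itv_hi I - itv_lo I.

Definition is_itv {R : realType} (A B : R) (I : interval R) : Prop :=
  exists (l r : bool) (a b : R),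
    I = Interval (BSide l a) (BSide r b) /\ [/\ A <= a, a < b & b <= B].

Definition overlap {R : realType} (A B : R) (X Y : set R) : Prop :=
  exists I : interval R, is_itv A B I /\ [set` I] `<=` X `&` Y.

Definition is_Isigma {R : realType} (A B : R) (X : set R) : Prop :=
  exists T : {fset interval R},
    [/\ T != fset0, (forall I, I \in T -> is_itv A B I) &
        X = \bigcup_(I in [set` T]) [set` I]].

Definition Sbar {R : realType} (A B : R) (S : set (interval R)) : set (set R) :=
  [set X | is_Isigma A B X /\
    exists (P : {fset R}) (T : {fset interval R}),
      [/\ [set` P] `<=` [set` `[A, B]], [set` T] `<=` S &
          X = [set` P] `|` \bigcup_(I in [set` T]) interior [set` I]]].

(* A division is a finite set of bracketed intervals; the derived set [X'] is
   [limit_point X]. *)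
Definition is_division {R : realType} (A B : R) (S : set (interval R))
    (X : set R) (D : {fset interval R}) : Prop :=
  [/\ [set` D] `<=` S,
      (forall I J, I \in D -> J \in D -> I != J ->
        ~ overlap A B [set` I] [set` J]) &
      \bigcup_(I in [set` D]) closure [set` I] = limit_point X].

Definition div_norm {R : realType} (D : {fset interval R}) : R :=
  \big[Num.max/0]_(I <- D) itv_len I.

Definition division_point {R : realType} (D : {fset interval R}) (x : R) : Prop :=
  exists2 I, I \in D & x = itv_lo I \/ x = itv_hi I.

Definition riemann_succession {R : realType} (A B : R) (S : set (interval R))
    (X : set R) (D : nat -> {fset interval R}) : Prop :=
  (forall n, is_division A B S X (D n)) /\
  (div_norm (D n) @[n --> \oo] --> (0 : R)).

Definition occurring {R : realType} (F : set (nat -> {fset interval R})) :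
    set {fset interval R} :=
  [set D | exists Ds n, F Ds /\ Ds n = D].

Record division_family {R : realType} (A B : R) (S : set (interval R))
    (F : set (nat -> {fset interval R})) : Prop := DivisionFamily {
  family_riemann : forall D, F D ->
    exists2 X, Sbar A B S X & riemann_succession A B S X D;
  family_exists : forall X, Sbar A B S X ->
    exists2 D, F D & riemann_succession A B S X D;
  (* the indices only have to tend to infinity, not to increase *)
  family_subsequence : forall D (u : nat -> nat), F D ->
    u i @[i --> \oo] --> \oo -> F (fun i => D (u i));
  family_union : forall X1 X2 D1 D2,
    Sbar A B S X1 -> Sbar A B S X2 -> ~ overlap A B X1 X2 ->
    F D1 -> riemann_succession A B S X1 D1 ->
    F D2 -> riemann_succession A B S X2 D2 ->
    F (fun n => D1 n `|` D2 n)%fset;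
  (* The condition is symmetric in the two abutting intervals, so [I1] is
     taken to be the left-hand one. *)
  family_split : forall (I I1 I2 : interval R) (x : R) D,
    is_itv A B I -> is_itv A B I1 -> is_itv A B I2 ->
    Sbar A B S [set` I] -> Sbar A B S [set` I1] -> Sbar A B S [set` I2] ->
    itv_hi I1 = x -> itv_lo I2 = x ->
    [set` I] = [set` I1] `|` [set` I2] `|` [set x] ->
    F D -> riemann_succession A B S [set` I] D ->
    exists D1 D2 : nat -> {fset interval R},
      [/\ F D1, riemann_succession A B S [set` I1] D1,
          F D2, riemann_succession A B S [set` I2] D2 &
          forall n,
            (division_point (D n) x -> (D1 n `|` D2 n)%fset = D n) /\
            (forall J, J \in D n -> interior [set` J] x ->
              exists J1 J2,
                [/\ J1 \in D1 n, J2 \in D2 n,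
                    limit_point [set` J1] `|` limit_point [set` J2] =
                      limit_point [set` J] &
                    (D1 n `|` D2 n)%fset =
                      ((D n `\ J) `|` [fset J1; J2])%fset])];
  family_diff : forall X1 X2, Sbar A B S X1 -> Sbar A B S X2 ->
    X1 `<=` X2 -> X2 `\` limit_point X1 !=set0 ->
    Sbar A B S (X2 `\` limit_point X1);
  family_single : forall I, S I -> occurring F [fset I]%fset
}.

(* Lebesgue measurable, not merely Borel: Caratheodory measurable for the
   Lebesgue outer measure. *)
Definition lebesgue_measurable {R : realType} (E : set R) : Prop :=
  ((@wlength R idfun)^*%mu).-cara.-measurable E.

Definition density {R : realType} (g : interval R -> R) (E : set R)
    (I : interval R) : R :=
  g I * fine (completed_lebesgue_measure (E `&` [set` I])) / itv_len I.

(* Values of the sums of [k] over the divisions of W in G of norm less than e. *)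
Definition division_sums {R : realType} (A B : R) (S : set (interval R))
    (F : set (nat -> {fset interval R})) (k : interval R -> R) (e : R) :
    set (\bar R) :=
  [set (\sum_(I <- D) k I)%:E | D in
    [set D : {fset interval R} |
      [/\ occurring F D, is_division A B S [set` `[A, B]] D & div_norm D < e]]].

Definition upper_density_integral {R : realType} (A B : R)
    (S : set (interval R)) (F : set (nat -> {fset interval R}))
    (g : interval R -> R) (E : set R) : \bar R :=
  lim (ereal_sup (division_sums A B S F (density g E) e) @[e --> 0^'+]).

Definition lower_density_integral {R : realType} (A B : R)
    (S : set (interval R)) (F : set (nat -> {fset interval R}))
    (g : interval R -> R) (E : set R) : \bar R :=
  lim (ereal_inf (division_sums A B S F (density g E) e) @[e --> 0^'+]).

Definition division_variation {R : realType} (A B : R) (S : set (interval R))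
    (F : set (nat -> {fset interval R})) (g : interval R -> R) : \bar R :=
  lim (ereal_sup (division_sums A B S F (fun I => `|g I|) e) @[e --> 0^'+]).

(* Main.v *)
Require Import Defs.
From mathcomp Require Import all_boot all_order all_algebra finmap.
From mathcomp Require Import all_classical all_reals all_analysis.
From mathcomp Require Import ring lra.
Import Order.TTheory GRing.Theory Num.Theory.
Import numFieldNormedType.Exports.
Local Open Scope classical_set_scope.
Local Open Scope ring_scope.
Set Implicit Arguments.
Unset Strict Implicit.
Unset Printing Implicit Defensive.

(** If the variation is finite, it bounds the density sums: over an interval [I]
the density of [g] on [E] is at most [`|g I|] in absolute value.

For the converse, fix a division [D]. As a function of [E], the density sum
[mu E] of [g] over [D] is an additive set function with bounded density with
respect to Lebesgue measure, and its total variation on [W] is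
[\sum_(I <- D) `|g I|] (lemma [abs_density_sum_full]). Finiteness of the two
integrals of [E] means that [mu E] remains bounded as [D] runs through all
sufficiently fine divisions ([density_integrals_fin_numP]), whereas infinite
variation provides divisions [D n], with norms tending to [0], on which the
total variations tend to infinity. This contradicts Nikodym's boundedness
theorem: a sequence of such set functions which is bounded on every measurable
set has bounded total variations ([nikodym_boundedness]).

The latter is proved by a gliding hump. If the total variations are unbounded
on [W], bisection finds arbitrarily short pieces of [W] on which they are still
unbounded ([unbounded_variation_short]). One therefore builds, step by step, a
set on which some [mu n] is large, together with a remaining piece, disjoint
from that set and with unbounded variations, so short that this [mu n] can
change by at most [1] through anything added there later ([hump]). The union of
all the sets so obtained is measurable, and the set functions are unbounded on
it. *)

(** * Lebesgue measure on the intervals of a division *)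

Section Measure.
Context {R : realType}.
Implicit Types (E X Y : set R) (I J : interval R).

Lemma lebesgue_measurable_itv I : lebesgue_measurable [set` I].
Proof. by apply: sub_caratheodory; exact: measurable_itv. Qed.

Lemma lebesgue_measurable0 : lebesgue_measurable (@set0 R).
Proof. exact: measurable0. Qed.

Lemma lebesgue_measurableI X Y :
  lebesgue_measurable X -> lebesgue_measurable Y ->
  lebesgue_measurable (X `&` Y).
Proof. exact: measurableI. Qed.

Lemma lebesgue_measurableU X Y :
  lebesgue_measurable X -> lebesgue_measurable Y ->
  lebesgue_measurable (X `|` Y).
Proof. exact: measurableU. Qed.

Lemma lebesgue_measurableD X Y :
  lebesgue_measurable X -> lebesgue_measurable Y ->
  lebesgue_measurable (X `\` Y).
Proof. exact: measurableD. Qed.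

Lemma lebesgue_measurable_bigcup (P : nat -> set R) :
  (forall k, lebesgue_measurable (P k)) ->
  lebesgue_measurable (\bigcup_k P k).
Proof. by move=> mP; apply: bigcupT_measurable. Qed.

Lemma completed_lebesgue_measure_mono X Y : X `<=` Y ->
  (completed_lebesgue_measure X <= completed_lebesgue_measure Y)%E.
Proof. by move=> XY; apply: le_outer_measure. Qed.

End Measure.

Definition trace_measure {R : realType} (E : set R) (I : interval R) : R :=
  fine (completed_lebesgue_measure (E `&` [set` I])).

Definition density_sum {R : realType} (g : interval R -> R)
    (D : {fset interval R}) (E : set R) : R :=
  \sum_(I <- D) density g E I.

Definition nonoverlapping_itvs {R : realType} (A B : R)
    (D : {fset interval R}) : Prop :=
  (forall I, I \in D -> is_itv A B I) /\
  (forall I J, I \in D -> J \in D -> I != J ->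
     ~ overlap A B [set` I] [set` J]).

Section TraceMeasure.
Context {R : realType} (A B : R).
Implicit Types (E X Y : set R) (I J : interval R).

Lemma itv_len_gt0 I : is_itv A B I -> 0 < itv_len I.
Proof. by move=> [l [r [a [b [-> [_ ab _]]]]]]; rewrite /itv_len subr_gt0. Qed.

Lemma completed_lebesgue_measure_itv I : is_itv A B I ->
  completed_lebesgue_measure [set` I] = (itv_len I)%:E.
Proof.
move=> [l [r [a [b [-> [_ ab _]]]]]].
rewrite (_ : completed_lebesgue_measure _ =
  lebesgue_measure [set` Interval (BSide l a) (BSide r b)]) //.
by rewrite lebesgue_measure_itv/= lte_fin ab EFinB.
Qed.

Lemma trace_fin_num E I : is_itv A B I ->
  completed_lebesgue_measure (E `&` [set` I]) \is a fin_num.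
Proof.
move=> iI; rewrite ge0_fin_numE; last exact: outer_measure_ge0.
apply: (@le_lt_trans _ _ (itv_len I)%:E); last exact: ltry.
rewrite -completed_lebesgue_measure_itv //.
by apply: completed_lebesgue_measure_mono; exact: subIsetr.
Qed.

Lemma trace_measure_ge0 E I : 0 <= trace_measure E I.
Proof. by apply: fine_ge0; exact: outer_measure_ge0. Qed.

Lemma trace_measure_mono X Y I : is_itv A B I ->
  X `&` [set` I] `<=` Y -> trace_measure X I <= trace_measure Y I.
Proof.
move=> iI XY; apply: fine_le; [exact: trace_fin_num..|].
by apply: completed_lebesgue_measure_mono => x [Xx Ix]; split => //; exact: XY.
Qed.

Lemma trace_measure_full X I : is_itv A B I -> [set` I] `<=` X ->
  trace_measure X I = itv_len I.
Proof.
move=> iI IX; rewrite /trace_measure (setIidr IX).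
by rewrite completed_lebesgue_measure_itv.
Qed.

Lemma trace_measure_le X I : is_itv A B I -> trace_measure X I <= itv_len I.
Proof.
move=> iI; rewrite -(trace_measure_full iI (@subsetT _ _)).
exact: trace_measure_mono.
Qed.

Lemma trace_measureU X Y I : is_itv A B I ->
  lebesgue_measurable X -> lebesgue_measurable Y -> X `&` Y = set0 ->
  trace_measure (X `|` Y) I = trace_measure X I + trace_measure Y I.
Proof.
move=> iI mX mY XY; rewrite /trace_measure -fineD; [|exact: trace_fin_num..].
congr fine; rewrite setIUl measureU //.
- by apply: lebesgue_measurableI => //; exact: lebesgue_measurable_itv.
- by apply: lebesgue_measurableI => //; exact: lebesgue_measurable_itv.
- by rewrite setIACA setIid XY set0I.
Qed.

Lemma trace_measure_le_itv X I (a b : R) : is_itv A B I -> a <= b ->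
  X `&` [set` I] `<=` [set` `[a, b]] -> trace_measure X I <= b - a.
Proof.
move=> iI ab Xab.
have cab : completed_lebesgue_measure [set` `[a, b]] = (b - a)%:E.
  rewrite (_ : completed_lebesgue_measure _ =
    lebesgue_measure [set` `[a, b]])//.
  rewrite lebesgue_measure_itv/= lte_fin lt_neqAle ab andbT EFinB.
  by case: eqVneq => //= ->; rewrite subee.
rewrite -lee_fin fineK; last exact: trace_fin_num.
by rewrite -cab; exact: completed_lebesgue_measure_mono.
Qed.

(** Two points [y < x] common to [I] and [J] would give the common interval
[`[y, x]]. *)
Lemma nonoverlap_sub_set1 I J : is_itv A B I ->
  ~ overlap A B [set` I] [set` J] ->
  exists z, [set` I] `&` [set` J] `<=` [set z].
Proof.
move=> iI nIJ.
have IJ1 x y : [set` I] x -> [set` J] x -> [set` I] y -> [set` J] y -> x <= y.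
  move=> Ix Jx Iy Jy; rewrite leNgt; apply/negP => yx; apply: nIJ.
  have [l [r [a [b [eI [Aa ab bB]]]]]] := iI.
  exists `[y, x]; split.
    exists true, false, y, x; split => //; split => //.
      apply: le_trans Aa _; move: Iy; rewrite eI/= in_itv/=.
      by case: (l) => /andP[]; [|move=> /ltW].
    apply: le_trans bB; move: Ix; rewrite eI/= in_itv/=.
    by case: (r) => /andP[_]; [move=> /ltW|].
  move=> z /= zyx; split => /=.
    by apply: (@interval_is_interval _ I y x).
  by apply: (@interval_is_interval _ J y x).
have [->|/set0P[z [Iz Jz]]] := eqVneq ([set` I] `&` [set` J]) set0.
  by exists 0; exact: sub0set.
by exists z => y [Iy Jy] /=; apply/eqP; rewrite eq_le !IJ1.
Qed.

Lemma trace_measure_finite X I : finite_set (X `&` [set` I]) ->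
  trace_measure X I = 0.
Proof.
move=> /finite_set_countable/countable_lebesgue_measure0 h.
by rewrite /trace_measure (_ : completed_lebesgue_measure _ =
  lebesgue_measure (X `&` [set` I]))// h.
Qed.

End TraceMeasure.

(** * Density sums and their variation *)

Section DensitySum.
Context {R : realType} (A B : R).
Variables (g : interval R -> R) (D : {fset interval R}).
Hypothesis itvD : forall I, I \in D -> is_itv A B I.
Implicit Types (X Y : set R) (I J : interval R).
Local Notation absg := (fun I => `|g I|).

Lemma abs_density_mono X Y I : is_itv A B I -> X `&` [set` I] `<=` Y ->
  density absg X I <= density absg Y I.
Proof.
move=> iI XY; rewrite ler_wpM2r ?invr_ge0 ?(ltW (itv_len_gt0 iI))//.
by rewrite ler_wpM2l//; exact: (trace_measure_mono iI).
Qed.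

Lemma densityU X Y I : is_itv A B I ->
  lebesgue_measurable X -> lebesgue_measurable Y -> X `&` Y = set0 ->
  density g (X `|` Y) I = density g X I + density g Y I.
Proof.
move=> iI mX mY XY; rewrite /density -/(trace_measure _ _).
by rewrite (trace_measureU iI mX mY XY) mulrDr mulrDl.
Qed.

Lemma density_sumU X Y :
  lebesgue_measurable X -> lebesgue_measurable Y -> X `&` Y = set0 ->
  density_sum g D (X `|` Y) = density_sum g D X + density_sum g D Y.
Proof.
move=> mX mY XY; rewrite /density_sum -big_split/=.
by apply: eq_big_seq => I /itvD iI; exact: densityU.
Qed.

Lemma normr_density X I : is_itv A B I -> `|density g X I| = density absg X I.
Proof.
move=> iI; rewrite !normrM normfV (gtr0_norm (itv_len_gt0 iI)).
by rewrite (ger0_norm (trace_measure_ge0 _ _)).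
Qed.

Lemma normr_density_sum X : `|density_sum g D X| <= density_sum absg D X.
Proof.
apply: le_trans (ler_norm_sum _ _ _) _; rewrite /density_sum big_seq.
rewrite [leRHS]big_seq; apply: ler_sum => I /itvD iI.
by rewrite normr_density.
Qed.

Lemma abs_density_sum_mono X Y : X `<=` Y ->
  density_sum absg D X <= density_sum absg D Y.
Proof.
move=> XY; rewrite /density_sum big_seq [leRHS]big_seq.
apply: ler_sum => I /itvD iI; apply: abs_density_mono => //.
by apply: subset_trans XY; exact: subIsetl.
Qed.

Lemma abs_density_le X I : is_itv A B I -> density absg X I <= `|g I|.
Proof.
move=> iI; rewrite ler_pdivrMr ?(itv_len_gt0 iI)//.
by rewrite ler_wpM2l//; exact: (trace_measure_le _ iI).
Qed.

Lemma abs_density_sum_le X : density_sum absg D X <= \sum_(I <- D) `|g I|.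
Proof.
rewrite /density_sum big_seq [leRHS]big_seq.
by apply: ler_sum => I /itvD iI; exact: abs_density_le.
Qed.

Lemma abs_density_sum_full :
  density_sum absg D [set` `[A, B]] = \sum_(I <- D) `|g I|.
Proof.
apply: eq_big_seq => I /itvD iI; rewrite /density -/(trace_measure _ _).
rewrite (trace_measure_full iI) ?mulfK ?gt_eqF ?(itv_len_gt0 iI)//.
move: iI => [l [r [a [b [-> [Aa _ bB]]]]]].
by apply: subitvP; rewrite subitvE !bnd_simp; case: l; case: r => /=;
  rewrite ?bnd_simp ?Aa ?bB.
Qed.

(** The density sum is absolutely continuous with bounded density
[\sum_I |g I| / itv_len I], so small sets carry little of it. *)
Lemma abs_density_sum_le_itv X (a b : R) : a <= b -> X `<=` [set` `[a, b]] ->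
  density_sum absg D X <= (\sum_(I <- D) `|g I| / itv_len I) * (b - a).
Proof.
move=> ab Xab; rewrite /density_sum mulr_suml big_seq [leRHS]big_seq.
apply: ler_sum => I /itvD iI.
rewrite mulrAC ler_wpM2r ?invr_ge0 ?(ltW (itv_len_gt0 iI))//.
rewrite ler_wpM2l//; apply: (trace_measure_le_itv iI) => // x [Xx _].
exact: Xab.
Qed.

End DensitySum.

Lemma abs_density_sumU {R : realType} (A B : R) (g : interval R -> R)
    (D : {fset interval R}) (X Y : set R) :
  (forall I, I \in D -> is_itv A B I) ->
  lebesgue_measurable X -> lebesgue_measurable Y ->
  density_sum (fun I => `|g I|) D (X `|` Y) <=
  density_sum (fun I => `|g I|) D X + density_sum (fun I => `|g I|) D Y.
Proof.
move=> itvD mX mY; rewrite -(setDUK (@subsetUl _ X Y)).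
rewrite (density_sumU _ itvD)//; first last.
- by rewrite setDIK.
- by apply: lebesgue_measurableD => //; exact: lebesgue_measurableU.
rewrite lerD2l; apply: (abs_density_sum_mono _ itvD) => x [[]//].
Qed.

(** Hahn decomposition: the intervals on which [g] is positive cover a set [P]
which meets the others in finitely many points, so on [X `&` P] and [X `\` P]
no cancellation occurs, and one of the two carries half of the variation. *)
Lemma half_variation {R : realType} (A B : R) (g : interval R -> R)
    (D : {fset interval R}) (X : set R) :
  nonoverlapping_itvs A B D -> lebesgue_measurable X ->
  exists H, [/\ H `<=` X, lebesgue_measurable H &
    density_sum (fun I => `|g I|) D X <= 2 * `|density_sum g D H|].
Proof.
move=> [itvD novD] mX.
pose P := \bigcup_(I in [set` [fset I in D | 0 < g I]%fset]) [set` I].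
have mP : lebesgue_measurable P.
  apply: fin_bigcup_measurable; first exact: finite_fset.
  by move=> I _; exact: lebesgue_measurable_itv.
have mXP := lebesgue_measurableI mX mP.
have mXD := lebesgue_measurableD mX mP.
have XPD : (X `&` P) `&` (X `\` P) = set0.
  by apply/seteqP; split => // x [[_ Px] [_ /(_ Px)]].
(* [trace_measure X I] splits over [P]; one of the two parts vanishes, according
to the sign of [g I]. *)
have eX : density_sum (fun I => `|g I|) D X =
    density_sum g D (X `&` P) - density_sum g D (X `\` P).
  rewrite /density_sum -sumrB; apply: eq_big_seq => I ID.
  have iI := itvD _ ID.
  have tX : trace_measure X I =
      trace_measure (X `&` P) I + trace_measure (X `\` P) I.
    by rewrite -(trace_measureU iI)// setUIDK.
  rewrite /density -!/(trace_measure _ _) -mulrBl -mulrBr; congr (_ / _).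
  have [gI|gI] := ltP 0 (g I).
    suff E : trace_measure (X `\` P) I = 0.
      by rewrite tX E gtr0_norm// addr0 subr0.
    rewrite trace_measure_finite// (_ : _ `&` _ = set0)//.
    apply/seteqP; split => // x [[_ nPx] Ix]; apply: nPx; exists I => //=.
    by rewrite !inE/= ID.
  suff E : trace_measure (X `&` P) I = 0.
    by rewrite tX E ler0_norm// add0r sub0r mulrN mulNr.
  apply: trace_measure_finite.
  have /choice[z zP] : forall J, exists z, J \in D -> 0 < g J ->
      [set` J] `&` [set` I] `<=` [set z].
    move=> J; have [[JD gJ]|nJ] := pselect (J \in D /\ 0 < g J); last first.
      by exists 0 => JD gJ; case: nJ.
    have [z ?] : exists z, [set` J] `&` [set` I] `<=` [set z].
      apply: (nonoverlap_sub_set1 (itvD _ JD)); apply: novD => //.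
      by apply: contraTneq gJ => ->; rewrite -leNgt.
    by exists z.
  apply: (@sub_finite_set _ _ (z @` [set` D])); last first.
    by apply: finite_image; exact: finite_fset.
  move=> x [[_ [J /=]]]; rewrite !inE/= => /andP[JD gJ] Jx Ix.
  by exists J => //; apply/esym/(zP J JD gJ).
have [h|h] := leP (density_sum (fun I => `|g I|) D X)
                  (2 * `|density_sum g D (X `&` P)|).
  by exists (X `&` P); split => //; exact: subIsetl.
exists (X `\` P); split => //.
rewrite eX in h *.
have := ler_norm (density_sum g D (X `&` P)).
have := ler_norm (- density_sum g D (X `\` P)); rewrite normrN.
lra.
Qed.

(** * Nikodym boundedness *)

Section NikodymBoundedness.
Context {R : realType} (A B : R).
Hypothesis leAB : A <= B.
Variables (g : interval R -> R) (D : nat -> {fset interval R}).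
Hypothesis novD : forall n, nonoverlapping_itvs A B (D n).
Implicit Types (P X Y : set R).

Local Notation mu n := (density_sum g (D n)).
Local Notation nu n := (density_sum (fun I => `|g I|) (D n)).
Local Notation itvD n := (proj1 (novD n)).

Definition unbounded_variation X : Prop := forall C : R, exists n, C < nu n X.

Lemma unbounded_variationU X Y :
  lebesgue_measurable X -> lebesgue_measurable Y ->
  unbounded_variation (X `|` Y) ->
  unbounded_variation X \/ unbounded_variation Y.
Proof.
move=> mX mY uXY; apply: contrapT => /not_orP[].
move=> /existsNP[C /forallNP hC] /existsNP[C' /forallNP hC'].
have [n] := uXY (C + C'); apply/negP; rewrite -leNgt.
apply: (le_trans (abs_density_sumU g (itvD n) mX mY)).
by apply: lerD; rewrite leNgt; apply/negP; [exact: hC|exact: hC'].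
Qed.

(** Bisection: one of the two halves of a set with unbounded variation again has
unbounded variation. *)
Lemma unbounded_variation_short X (d : R) : X `<=` [set` `[A, B]] ->
  lebesgue_measurable X -> unbounded_variation X -> 0 < d ->
  exists Y (a b : R), [/\ Y `<=` X, lebesgue_measurable Y,
    unbounded_variation Y, Y `<=` [set` `[a, b]] & a <= b <= a + d].
Proof.
move=> XAB mX uX d0.
have mXI a b : lebesgue_measurable (X `&` [set` `[a, b]]).
  by apply: lebesgue_measurableI => //; exact: lebesgue_measurable_itv.
have halve j : exists a,
    unbounded_variation (X `&` [set` `[a, a + (B - A) / 2 ^+ j]]).
  elim: j => [|j [a ua]].
    by exists A; rewrite expr0 divr1 addrC subrK (setIidl XAB).
  pose l := (B - A) / 2 ^+ j.+1.
  have l0 : 0 <= l by rewrite divr_ge0 ?subr_ge0 ?exprn_ge0.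
  have el : (B - A) / 2 ^+ j = l + l.
    by rewrite /l exprS invfM; field.
  have := @unbounded_variationU _ _ (mXI a (a + l)) (mXI (a + l) (a + l + l)).
  rewrite -setIUr.
  have -> : [set` `[a, a + l]] `|` [set` `[a + l, a + l + l]] =
      [set` `[a, a + (B - A) / 2 ^+ j]].
    apply/seteqP; rewrite el; split => x /=; rewrite !in_itv/=.
      by case=> /andP[xa xl]; apply/andP; split; lra.
    move=> /andP[ax xl]; have [xal|alx] := leP x (a + l); [left|right].
      by rewrite ax.
    by rewrite (ltW alx) -addrA.
  by move=> /(_ ua)[u|u]; [exists a|exists (a + l)].
have [j jd] : exists j, (B - A) / 2 ^+ j <= d.
  exists (Num.bound ((B - A) / d)); rewrite ler_pdivrMr ?exprn_gt0//.
  by rewrite mulrC -ler_pdivrMr// ltW// upper_nthrootP.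
have [a ua] := halve j.
have lj0 : 0 <= (B - A) / 2 ^+ j by rewrite divr_ge0 ?subr_ge0 ?exprn_ge0.
exists (X `&` [set` `[a, a + (B - A) / 2 ^+ j]]), a, (a + (B - A) / 2 ^+ j).
split => //; lra.
Qed.

(** One hump. The variation of [mu n] on [X] is taken so large that, even after
a short part [X'] is put aside for later, some [H] inside [X `\` X'] satisfies
[k + `|mu m P| <= `|mu n H|] for all [m]; then [P'] is [P `|` H]. *)
Lemma hump (k : nat) P X :
  lebesgue_measurable P -> lebesgue_measurable X ->
  X `<=` [set` `[A, B]] -> P `&` X = set0 -> unbounded_variation X ->
  (exists M : R, forall n, `|mu n P| <= M) ->
  exists P' X', [/\ lebesgue_measurable P' /\ lebesgue_measurable X',
    unbounded_variation X',
    P `<=` P', P' `|` X' `<=` P `|` X /\ P' `&` X' = set0 &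
    exists n, k%:R <= `|mu n P'| /\ nu n X' <= 1].
Proof.
move=> mP mX XAB PX0 uX [M bM].
(* Of the variation on [X], [1] may be lost to [X'], and half of the rest to
cancellation; [k%:R + M] remains. *)
have [n hn] := uX (2 * (k%:R + M) + 1).
pose C := \sum_(I <- D n) `|g I| / itv_len I.
have C0 : 0 <= C.
  rewrite /C big_seq; apply: sumr_ge0 => I /(itvD n) iI.
  by rewrite divr_ge0// (ltW (itv_len_gt0 iI)).
(* [C] bounds the density of [mu n], so length [(C + 1)^-1] is short enough. *)
have d0 : 0 < (C + 1)^-1 by rewrite invr_gt0; lra.
have [X' [a [b [X'X mX' uX' X'ab abd]]]] :=
  unbounded_variation_short XAB mX uX d0.
have nuX' : nu n X' <= 1.
  have /andP[ab bd] := abd.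
  apply: (le_trans (abs_density_sum_le_itv g (itvD n) ab X'ab)); rewrite -/C.
  have : C * (b - a) <= C * (C + 1)^-1 by rewrite ler_wpM2l//; lra.
  move=> /le_trans; apply; rewrite ler_pdivrMr; lra.
have mXX' := lebesgue_measurableD mX mX'.
have [H [HX mH bH]] := half_variation g (novD n) mXX'.
have nuXX' : nu n X <= nu n X' + nu n (X `\` X').
  by rewrite -{1}(setDUK X'X); exact: (abs_density_sumU g (itvD n) mX' mXX').
have PH0 : P `&` H = set0.
  by apply/seteqP; split => // x [Px /HX[Xx _]]; rewrite -PX0.
exists (P `|` H), X'; split => //.
- by split => //; exact: lebesgue_measurableU.
- split; last first.
    apply/seteqP; split => // x [[Px|/HX[_ //]] X'x].
    by rewrite -PX0; split => //; exact: X'X.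
  move=> x [[Px|/HX[Xx _]]|/X'X Xx]; [by left|by right|by right].
- exists n; split => //.
  rewrite (density_sumU _ (itvD n) mP mH PH0).
  have := lerB_normD (mu n H) (mu n P); rewrite [mu n H + _]addrC.
  have := bM n; lra.
Qed.

(** Nikodym's boundedness theorem for density sums, by a gliding hump. If the
variations were unbounded, iterating the previous lemma would give increasing
sets [P k] and decreasing sets [X k]; the union [E] of the [P k] agrees with
[P k.+1] outside [X k.+1], hence some [mu n E] has absolute value at least
[k - 1]. *)
Lemma nikodym_boundedness :
  (forall E, E `<=` [set` `[A, B]] -> lebesgue_measurable E ->
     exists M : R, forall n, `|mu n E| <= M) ->
  exists M : R, forall n, \sum_(I <- D n) `|g I| <= M.
Proof.
move=> bmu; apply: contrapT => /forallNP nbM.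
have uAB : unbounded_variation [set` `[A, B]].
  move=> C; have /existsNP[n /negP] := nbM C; rewrite -ltNge => hC.
  by exists n; rewrite (abs_density_sum_full _ (itvD n)).
(* A state consists of the part [s.1] of [E] already built and the piece [s.2]
from which the rest of [E] is taken. *)
pose good (s : set R * set R) := [/\ lebesgue_measurable s.1,
  lebesgue_measurable s.2, s.1 `|` s.2 `<=` [set` `[A, B]], s.1 `&` s.2 = set0 &
  unbounded_variation s.2].
pose step k (s s' : set R * set R) := [/\ s.1 `<=` s'.1,
  s'.1 `|` s'.2 `<=` s.1 `|` s.2 &
  exists n, k%:R <= `|mu n s'.1| /\ nu n s'.2 <= 1].
have /choice[f fP] : forall ks : nat * (set R * set R), exists s',
    good ks.2 -> good s' /\ step ks.1 ks.2 s'.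
  move=> [k s] /=; have [gs|ngs] := pselect (good s); last by exists s.
  have [mP mX sAB s0 uX] := gs.
  have XAB : s.2 `<=` [set` `[A, B]] by move=> x sx; apply: sAB; right.
  have PAB : s.1 `<=` [set` `[A, B]] by move=> x sx; apply: sAB; left.
  have [P' [X' [[mP' mX'] uX' PP' [sub dis] far]]] :=
    hump k mP mX XAB s0 uX (bmu _ PAB mP).
  exists (P', X') => _; split; split => //=.
  by apply: subset_trans sAB.
pose s := fix s k :=
  if k is k'.+1 then f (k', s k') else (set0, [set` `[A, B]]).
have gs k : good (s k).
  elim: k => [|k gk]; last by have [] := fP (k, s k) gk.
  split => //=; first exact: lebesgue_measurable0.
  - exact: lebesgue_measurable_itv.
  - by rewrite set0U.
  - by rewrite set0I.
have ns k : step k (s k) (s k.+1) by have [] := fP (k, s k) (gs k).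
have Ps k i : (s k).1 `<=` (s (i + k)%N).1.
  elim: i => [|i ih]; first by [].
  by rewrite addSn; apply: subset_trans ih _; have [] := ns (i + k)%N.
have PXs k i : (s (i + k)%N).1 `|` (s (i + k)%N).2 `<=` (s k).1 `|` (s k).2.
  elim: i => [|i ih]; first by [].
  by rewrite addSn; apply: subset_trans _ ih; have [] := ns (i + k)%N.
pose E := \bigcup_k (s k).1.
have mE : lebesgue_measurable E.
  by apply: lebesgue_measurable_bigcup => k; have [] := gs k.
have EPX k : E `<=` (s k).1 `|` (s k).2.
  move=> x [j _ sjx]; have [jk|/ltnW kj] := leqP j k.
    by left; rewrite -(subnK jk); exact: Ps.
  by apply: (PXs k (j - k)%N); rewrite subnK//; left.
have EAB : E `<=` [set` `[A, B]].
  by apply: subset_trans (EPX 0) _; have [] := gs 0.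
have [M bM] := bmu E EAB mE.
pose k := Num.bound `|M + 1|.
have [_ _ [n [kn n1]]] := ns k.
have [mP mX _ dis _] := gs k.+1.
have eE : E = (s k.+1).1 `|` (E `&` (s k.+1).2).
  apply/seteqP; split => [x Ex|x [Px|[]//]]; last by exists k.+1.
  by case: (EPX k.+1 x Ex) => h; [left|right].
have := bM n; rewrite eE (density_sumU _ (itvD n))//; last first.
- by rewrite setICA dis setI0.
- exact: lebesgue_measurableI.
have := normr_density_sum g (itvD n) (E `&` (s k.+1).2).
have := abs_density_sum_mono g (itvD n) (@subIsetr _ E (s k.+1).2).
have := lerB_normD (mu n (s k.+1).1) (mu n (E `&` (s k.+1).2)).
have : M + 1 < k%:R :> R.
  exact: (le_lt_trans (ler_norm _) (archi_boundP (normr_ge0 _))).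
lra.
Qed.

End NikodymBoundedness.

(** * Density integrals as limits over fine divisions *)

Definition fine_division {R : realType} (A B : R) (S : set (interval R))
    (F : set (nat -> {fset interval R})) (e : R) : set {fset interval R} :=
  [set D : {fset interval R} |
    [/\ occurring F D, is_division A B S [set` `[A, B]] D & div_norm D < e]].

Section FineDivisions.
Context {R : realType} (A B : R) (S : set (interval R)).
Variable F : set (nat -> {fset interval R}).
Implicit Types (k g : interval R -> R) (E : set R) (e : R).

Lemma fine_division_mono e e' : e <= e' ->
  fine_division A B S F e `<=` fine_division A B S F e'.
Proof. by move=> ee' D [oD dD nD]; split => //; exact: lt_le_trans ee'. Qed.

Lemma fine_division_minl e e' :
  fine_division A B S F (Num.min e e') `<=` fine_division A B S F e.
Proof. by apply: fine_division_mono; rewrite ge_min lexx. Qed.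

Lemma fine_division_minr e e' :
  fine_division A B S F (Num.min e e') `<=` fine_division A B S F e'.
Proof. by apply: fine_division_mono; rewrite ge_min lexx orbT. Qed.

Lemma fine_division_nonoverlapping e D : (forall I, S I -> is_itv A B I) ->
  fine_division A B S F e D -> nonoverlapping_itvs A B D.
Proof.
by move=> hS [_ [DS nov _] _]; split => // I ID; apply: hS; exact: DS.
Qed.

Lemma fine_division_nonempty e : Sbar A B S [set` `[A, B]] ->
  division_family A B S F -> 0 < e -> fine_division A B S F e !=set0.
Proof.
move=> hW hF e0; have [D FD [dD D0]] := family_exists hF hW.
have [n ne] : exists n, div_norm (D n) < e.
  by apply: (@filter_ex _ \oo); exact: (cvgr_lt _ D0).
by exists (D n); split => //; exists D, n.
Qed.

(** The sets of sums shrink with [e], so the limits at [0] are an infimum and a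
supremum over [e > 0]. *)
Lemma lim_sup_sumsE k :
  lim (ereal_sup (division_sums A B S F k e) @[e --> 0^'+]) =
  ereal_inf [set ereal_sup (division_sums A B S F k e) | e in [set` `]0, +oo[]].
Proof.
apply: cvg_lim => //; apply: nondecreasing_at_right_cvge => //.
by move=> e e' _ _ ee'; apply: ereal_sup_le; apply: image_subset;
  exact: fine_division_mono.
Qed.

Lemma lim_inf_sumsE k :
  lim (ereal_inf (division_sums A B S F k e) @[e --> 0^'+]) =
  ereal_sup [set ereal_inf (division_sums A B S F k e) | e in [set` `]0, +oo[]].
Proof.
apply: cvg_lim => //; apply: nonincreasing_at_right_cvge => //.
by move=> e e' _ _ ee'; apply: ereal_inf_le_tmp; apply: image_subset;
  exact: fine_division_mono.
Qed.

Lemma lim_sup_sums_ltyP k :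
  (lim (ereal_sup (division_sums A B S F k e) @[e --> 0^'+]) < +oo)%E <->
  exists e (M : R), 0 < e /\
    forall D, fine_division A B S F e D -> \sum_(I <- D) k I <= M.
Proof.
rewrite lim_sup_sumsE; split.
  move=> /ereal_inf_lt[y [e /=]]; rewrite in_itv/= andbT => e0 <- fin.
  exists e, (fine (ereal_sup (division_sums A B S F k e))); split => // D eD.
  have : ((\sum_(I <- D) k I)%:E <= ereal_sup (division_sums A B S F k e))%E.
    by apply: ereal_sup_ubound; exists D.
  by move: fin; case: ereal_sup => //= r _; rewrite lee_fin.
move=> [e [M [e0 eM]]]; apply: (@le_lt_trans _ _ M%:E); last exact: ltry.
apply: (@le_trans _ _ (ereal_sup (division_sums A B S F k e))).
  by apply: ereal_inf_lbound; exists e => //=; rewrite in_itv/= e0.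
by apply: ge_ereal_sup => _ [D eD <-]; rewrite lee_fin; exact: eM.
Qed.

Lemma lim_inf_sums_gtNyP k :
  (-oo < lim (ereal_inf (division_sums A B S F k e) @[e --> 0^'+]))%E <->
  exists e (M : R), 0 < e /\
    forall D, fine_division A B S F e D -> M <= \sum_(I <- D) k I.
Proof.
rewrite lim_inf_sumsE; split.
  move=> /ereal_sup_gt[y [e /=]]; rewrite in_itv/= andbT => e0 <- fin.
  exists e, (fine (ereal_inf (division_sums A B S F k e))); split => // D eD.
  have : (ereal_inf (division_sums A B S F k e) <= (\sum_(I <- D) k I)%:E)%E.
    by apply: ereal_inf_lbound; exists D.
  by move: fin; case: ereal_inf => //= r _; rewrite lee_fin.
move=> [e [M [e0 eM]]]; apply: (@lt_le_trans _ _ M%:E); first exact: ltNyr.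
apply: (@le_trans _ _ (ereal_inf (division_sums A B S F k e))).
  by apply: le_ereal_inf_tmp => _ [D eD <-]; rewrite lee_fin; exact: eM.
by apply: ereal_sup_ubound; exists e => //=; rewrite in_itv/= e0.
Qed.

Hypothesis fine_nonempty : forall e, 0 < e -> fine_division A B S F e !=set0.

(** Two norms [e] and [e'] are compared through a division finer than both. *)
Lemma lower_le_upper_density_integral g E :
  (lower_density_integral A B S F g E <= upper_density_integral A B S F g E)%E.
Proof.
rewrite /lower_density_integral /upper_density_integral.
rewrite lim_inf_sumsE lim_sup_sumsE.
apply: ge_ereal_sup => _ [e /= + <-]; rewrite in_itv/= andbT => e0.
apply: le_ereal_inf_tmp => _ [e' /= + <-]; rewrite in_itv/= andbT => e'0.
have [D mD] : fine_division A B S F (Num.min e e') !=set0.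
  by apply: fine_nonempty; rewrite lt_min e0.
apply: (@le_trans _ _ (\sum_(I <- D) density g E I)%:E).
  by apply: ereal_inf_lbound; exists D => //; exact: fine_division_minl mD.
by apply: ereal_sup_ubound; exists D => //; exact: fine_division_minr mD.
Qed.

Lemma density_integrals_fin_numP g E :
  (lower_density_integral A B S F g E \is a fin_num /\
   upper_density_integral A B S F g E \is a fin_num) <->
  exists e (M : R), 0 < e /\
    forall D, fine_division A B S F e D -> `|density_sum g D E| <= M.
Proof.
split=> [[]|[e [M [e0 eM]]]].
  rewrite !fin_numElt => /andP[/lim_inf_sums_gtNyP[e [M [e0 eM]]] _].
  move=> /andP[_ /lim_sup_sums_ltyP[e' [M' [e'0 eM']]]].
  exists (Num.min e e'), (Num.max (- M) M'); split; first by rewrite lt_min e0.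
  move=> D mD; rewrite ler_norml lerNl le_max le_max.
  rewrite lerN2 /density_sum (eM _ (fine_division_minl mD)).
  by rewrite (eM' _ (fine_division_minr mD)) orbT.
have low : (-oo < lower_density_integral A B S F g E)%E.
  apply/lim_inf_sums_gtNyP; exists e, (- M); split => // D /eM.
  by rewrite ler_norml => /andP[].
have upp : (upper_density_integral A B S F g E < +oo)%E.
  apply/lim_sup_sums_ltyP; exists e, M; split => // D /eM.
  by rewrite ler_norml => /andP[].
have le := lower_le_upper_density_integral g E.
rewrite !fin_numElt low upp (le_lt_trans le upp) (lt_le_trans low le).
by [].
Qed.

End FineDivisions.

Theorem mainTheorem17 (R : realType) (A B : R) (hAB : A < B)
    (S : set (interval R)) (hS : forall I, S I -> is_itv A B I)
    (hW : Sbar A B S [set` `[A, B]])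
    (F : set (nat -> {fset interval R})) (hF : division_family A B S F)
    (g : interval R -> R) :
  (forall E : set R, E `<=` [set` `[A, B]] -> lebesgue_measurable E ->
     lower_density_integral A B S F g E \is a fin_num /\
     upper_density_integral A B S F g E \is a fin_num) <->
  (division_variation A B S F g < +oo)%E.
Proof.
have ne e := @fine_division_nonempty _ A B S F e hW hF.
split=> [fin|/lim_sup_sums_ltyP[e [M [e0 eM]]] E _ _]; last first.
  apply/(density_integrals_fin_numP ne); exists e, M; split => // D eD.
  have [itvD _] := fine_division_nonoverlapping hS eD.
  apply: le_trans (eM _ eD); apply: le_trans (normr_density_sum g itvD E) _.
  exact: (abs_density_sum_le g itvD).
apply: contrapT => /lim_sup_sums_ltyP nbv.
have /choice[D DP] : forall n : nat, exists D,
    fine_division A B S F n.+1%:R^-1 D /\ n%:R < \sum_(I <- D) `|g I|.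
  move=> n; apply: contrapT => /forallNP nD; apply: nbv.
  exists n.+1%:R^-1, n%:R; split; first by rewrite invr_gt0.
  by move=> D eD; rewrite leNgt; apply/negP => gD; apply: (nD D).
have [] := @nikodym_boundedness _ A B (ltW hAB) g D.
- by move=> n; apply: (fine_division_nonoverlapping hS (DP n).1).
- move=> E EAB mE.
  have /(density_integrals_fin_numP ne)[e [M [e0 eM]]] := fin E EAB mE.
  pose N := Num.bound e^-1.
  (* The bound [M] holds for the divisions of norm less than [e], hence for all
  but the first [N]. *)
  exists (\big[Num.max/M]_(i < N) `|density_sum g (D i) E|) => n.
  have [nN|Nn] := ltnP n N.
    pose f (i : 'I_N) := `|density_sum g (D i) E|.
    exact: (le_bigmax _ f (Ordinal nN)).
  apply: (@le_trans _ _ M); last exact: bigmax_ge_id.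
  apply: eM; apply: fine_division_mono (DP n).1.
  rewrite invf_ple ?posrE// ltW//.
  apply: lt_le_trans (archi_boundP _) _; first by rewrite invr_ge0 ltW.
  by rewrite ler_nat leqW.
- move=> M /(_ (Num.bound `|M|)); apply/negP; rewrite -ltNge.
  apply: lt_trans (DP _).2.
  exact: le_lt_trans (ler_norm _) (archi_boundP (normr_ge0 _)).
Qed.
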